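(* Let $\mathcal{D}$ be a (possibly infinite) strong digraph. Then the infimum of $1-\lambda_S(\gamma)$ taken over all proper cycles $\gamma$ of $\mathcal{D}$ is positive on $\mathcal{S}(\mathcal{D})$ if and only if $\mathcal{D}$ admits a finite cycle transversal and the lengths of all cycles of $\mathcal{D}$ are uniformly bounded above: $$\inf_{\gamma\subset\mathcal{D}}\ \bigl(1-\lambda_S(\gamma)\bigr)>0\quad \forall\, S\in\mathcal{S}(\mathcal{D})\iff |sct(\mathcal{D})|<\infty\ \text{ and }\ \ell_{max}(\mathcal{D})<\infty.$$
   Context: Digraphs have vertex-set $V(\mathcal{D})$ and arc-set $A(\mathcal{D})$, may be infinite, may have loops, but have no multiple arcs. A digraph is strong (strongly connected) if for any pair of distinct vertices $v,w$ there is a path from $v$ to $w$; each vertex of a strong digraph has at least one arc leaving it. A directed cycle is a finite strong digraph in which exactly one arc leaves each vertex (a loop is a cycle of length 1, an undirected edge, i.e. a pair of opposite arcs, is a cycle of length 2); ''cycle'' always means directed cycle, and $\ell(\gamma)$, the length of $\gamma$, is its number of arcs. A cycle $\gamma$ of $\mathcal{D}$ is proper, written $\gamma\subset\mathcal{D}$, if $\ell(\gamma)<|A(\mathcal{D})|$. $\ell_{max}(\mathcal{D})$ is the length of a longest cycle of $\mathcal{D}$, with $\ell_{max}(\mathcal{D})=\infty$ if cycle lengths are unbounded. A cycle transversal of $\mathcal{D}$ is a set of vertices whose removal (together with all incident arcs) leaves a digraph with no cycles; $|sct(\mathcal{D})|$ is the size of a smallest cycle transversal, and $|sct(\mathcal{D})|=\infty$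 if there is no finite one. A weighting of $\mathcal{D}$ is a positive function on its arcs. It is substochastic if for each vertex the sum of the weights of the arcs leaving it (its out-weight) is not greater than $1$. $\mathcal{S}(\mathcal{D})$ is the class of all substochastic weightings of $\mathcal{D}$. For $S\in\mathcal{S}(\mathcal{D})$ and a cycle $\gamma$ of $\mathcal{D}$, $\lambda_S(\gamma)$ is the spectral radius (Perron root) of the weighted adjacency matrix of $\gamma$ weighted by $S$; it equals $S(\gamma)^{1/\ell(\gamma)}$, where $S(\gamma)$ is the product of the weights of the arcs of $\gamma$.
   Formalization: The digraph is assumed to admit at least one substochastic weighting (equivalently, to have countably many vertices); otherwise the claim fails, e.g. for the complete digraph on an uncountable set, where the left side is vacuously true and the right side false. *)

(* Defs.v *)
From mathcomp Require Import all_boot all_order all_algebra.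
From mathcomp Require Import all_classical all_reals all_analysis.
From mathcomp Require Import finmap complex.

Set Implicit Arguments.
Unset Strict Implicit.
Unset Printing Implicit Defensive.

Import Order.TTheory GRing.Theory Num.Theory.

Local Open Scope classical_set_scope.
Local Open Scope ring_scope.
Local Open Scope complex_scope.
Local Open Scope card_scope.

(* Vertices and arcs are subsets of an ambient type, so that subdigraphs (in
   particular cycles) of a digraph are again digraphs over the same type. The
   arc (v, w) goes from v to w. *)
Record digraph (T : Type) := Digraph {
  vset : set T;
  aset : set (T * T);
  aset_vset : forall a, aset a -> vset a.1 /\ vset a.2
}.

Definition subdigraph (T : Type) (H D : digraph T) : Prop :=
  vset H `<=` vset D /\ aset H `<=` aset D.

Definition connects (T : Type) (D : digraph T) (v w : T) : Prop :=
  exists p : seq T,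
    path (fun x y => `[< aset D (x, y) >]) v p /\ last v p = w.

(* The second clause follows from the first one when there are at least two
   vertices; it only excludes the digraph made of one vertex and no loop. *)
Definition strong (T : Type) (D : digraph T) : Prop :=
  (forall v w, vset D v -> vset D w -> v <> w -> connects D v w) /\
  (forall v, vset D v -> exists w, aset D (v, w)).

(* The digraph without vertices is not a cycle. *)
Definition is_cycle (T : Type) (g : digraph T) : Prop :=
  [/\ vset g !=set0, finite_set (vset g), strong g &
      forall v, vset g v -> exists! w, aset g (v, w)].

Definition cycle_of (T : Type) (g D : digraph T) : Prop :=
  is_cycle g /\ subdigraph g D.

(* Meaningful when aset g is finite, as it is for a cycle. *)
Definition cycle_length (T : choiceType) (g : digraph T) : nat :=
  #|` fset_set (aset g)|.

(* The last condition is cycle_length g < |A(D)|, as cardinals. *)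
Definition proper_cycle_of (T : choiceType) (g D : digraph T) : Prop :=
  cycle_of g D /\ ~~ (aset D #<= `I_(cycle_length g)).

Definition bounded_cycle_lengths (T : choiceType) (D : digraph T) : Prop :=
  exists L : nat, forall g, cycle_of g D -> (cycle_length g <= L)%N.

Lemma remove_vertices_subproof (T : Type) (D : digraph T) (X : set T) a :
  (aset D `&` [set a | ~ X a.1 /\ ~ X a.2]) a ->
  (vset D `\` X) a.1 /\ (vset D `\` X) a.2.
Proof. by case=> /aset_vset[? ?] [? ?]. Qed.

Definition remove_vertices (T : Type) (D : digraph T) (X : set T) :
    digraph T :=
  Digraph (@remove_vertices_subproof T D X).

Definition cycle_transversal (T : Type) (D : digraph T) (X : set T) : Prop :=
  X `<=` vset D /\ forall g, ~ cycle_of g (remove_vertices D X).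

Definition has_finite_transversal (T : Type) (D : digraph T) : Prop :=
  exists X : set T, finite_set X /\ cycle_transversal D X.

(* A weighting is a total function on pairs; its values outside aset D play no
   role. *)
Definition weighting (R : realType) (T : Type) (D : digraph T)
    (S : T * T -> R) : Prop :=
  forall a, aset D a -> 0 < S a.

Definition out_weight (R : realType) (T : choiceType) (D : digraph T)
    (S : T * T -> R) (v : T) : \bar R :=
  \esum_(a in aset D `&` [set a | a.1 = v]) (S a)%:E.

(* This set is empty when some out-degree is uncountable; for a strong digraph
   it is nonempty if and only if vset D is countable. *)
Definition substochastic (R : realType) (T : choiceType) (D : digraph T) :
    set (T * T -> R) :=
  [set S | weighting D S /\
           forall v, vset D v -> (out_weight D S v <= 1)%E].

Arguments substochastic R {T} D.

Definition spectral_radius (R : realType) (n : nat) (M : 'M[R[i]]_n) : R :=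
  sup [set Normc.normc z | z in [set z | eigenvalue M z]].

(* Rows and columns are indexed by an enumeration of the finite set vset g. *)
Definition weighted_adjacency (R : realType) (T : choiceType) (g : digraph T)
    (S : T * T -> R) : 'M[R[i]]_#|{: fset_set (vset g)}| :=
  \matrix_(i, j)
    let a := (val (enum_val i), val (enum_val j)) in
    if `[< aset g a >] then (S a)%:C else 0.

Definition perron_root (R : realType) (T : choiceType) (S : T * T -> R)
    (g : digraph T) : R :=
  spectral_radius (weighted_adjacency g S).

(* Main.v *)
(* An eigenvector v of the weighted adjacency matrix of a cycle with successor
   map s satisfies z v_(s i) = w_i v_i; multiplying over all i shows that every
   eigenvalue has z^l = S(gamma), so the Perron root is S(gamma)^(1/l).

   If X is a finite transversal and all cycles have length at most L, then a
   cycle with Perron root close to 1 has all its weights above 1/2. At most one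
   arc leaving a vertex weighs more than 1/2, so there is at most one such cycle
   through each vertex of X, and a proper cycle has Perron root < 1 because a
   strong digraph containing a cycle all of whose weights are 1 is that cycle.

   Conversely, if one of the two conditions fails, then for every finite set F
   and every N there is a cycle of length at least N times the number of its
   vertices in F. Choose cycles G 0, G 1, ... greedily, F being the set of
   vertices already used. Each vertex gives most of its out-weight to its arc in
   the first G n through it, and shares the rest between all its arcs so that
   the arcs of G n get a weight bounded below in terms of n only. The few
   vertices of G n used before then hardly affect the geometric mean of the
   weights along G n, which tends to 1. *)
Require Import Defs.
From mathcomp Require Import all_boot all_order all_algebra.
From mathcomp Require Import all_classical all_reals all_analysis.
From mathcomp Require Import finmap complex lra.
Local Open Scope classical_set_scope.

Set Implicit Arguments.
Unset Strict Implicit.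
Unset Printing Implicit Defensive.

Import Order.TTheory GRing.Theory Num.Theory numFieldNormedType.Exports.
Local Open Scope ring_scope.
Local Open Scope complex_scope.
Local Open Scope card_scope.

(** * Perron roots of weighted cycles *)

Lemma spectral_radius_cyclic (R : realType) (n : nat) (M : 'M[R[i]]_n)
    (s : 'I_n -> 'I_n) (w : 'I_n -> R) :
  (0 < n)%N -> (forall i j, exists m, iter m s i = j) ->
  (forall i, 0 < w i) ->
  (forall i j, M i j = if j == s i then (w i)%:C else 0) ->
  0 <= spectral_radius M /\ spectral_radius M ^+ n = \prod_i w i.
Proof.
move=> n_gt0 s_trans w_gt0 ME.
(* Transitivity makes [s] onto, hence bijective on the finite type ['I_n]. *)
have [t st] : exists t, cancel t s.
  have /choice[t tP] : forall i, exists j, s j = i.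
    move=> i; have [m] := s_trans (s i) i.
    by rewrite -iterSr iterS; exists (iter m s i).
  by exists t => i; rewrite tP.
have ts := canF_sym st.
have eigenE z : eigenvalue M z -> z ^+ n = (\prod_i w i)%:C.
  move=> /eigenvalueP[v vM v_neq0].
  have vE i : v 0 i * (w i)%:C = z * v 0 (s i).
    have /rowP/(_ (s i)) := vM; rewrite !mxE => <-.
    rewrite (bigD1 i)//= ME eqxx big1 ?addr0// => j ji.
    by rewrite ME (inj_eq (can_inj ts)) eq_sym (negPf ji) mulr0.
  have wC i : (w i)%:C != 0.
    by rewrite -(rmorph0 (real_complex R)) (inj_eq (@complexI _)) gt_eqF.
  (* One nonzero coordinate propagates along the orbit of [s], so the product of all coordinates can
     be cancelled below. *)
  have v_all i : v 0 i != 0.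
    have [j vj] : exists j, v 0 j != 0.
      apply/existsP; rewrite -negb_forall; apply: contra v_neq0 => /forallP v0.
      by apply/eqP/rowP => j; rewrite mxE; apply/eqP.
    have [m <-] := s_trans j i; elim: m => //= m IH.
    have : v 0 (iter m s j) * (w (iter m s j))%:C != 0 by rewrite mulf_neq0.
    by rewrite vE mulf_eq0 negb_or => /andP[].
  have : \prod_i (v 0 i * (w i)%:C) = \prod_i (z * v 0 (s i)).
    by apply: eq_bigr => i _; exact: vE.
  rewrite !big_split/= prodr_const card_ord.
  rewrite -(reindex_inj (can_inj ts) (P := predT) (F := fun i => v 0 i)).
  rewrite [LHS]mulrC => /mulIf <-.
    by rewrite rmorph_prod.
  by apply/prodf_neq0 => i _; exact: v_all.
(* The supremum of an empty set is a default value, so an eigenvalue is exhibited first; all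
   eigenvalues then share its modulus. *)
have [z0 z0M] : exists z, eigenvalue M z.
  have [|z zP] := elimT (closed_rootP (char_poly M)).
    by rewrite size_char_poly eqSS -lt0n.
  by exists z; rewrite eigenvalue_root_char.
have normX (z : R[i]) : Normc.normc (z ^+ n) = Normc.normc z ^+ n.
  by elim: (n) => [|m IH]; rewrite ?Normc.normc1// !exprS Normc.normcM IH.
have normc_ge0 (z : R[i]) : 0 <= Normc.normc z by case: z => a b; exact: sqrtr_ge0.
have normE z : eigenvalue M z -> Normc.normc z ^+ n = \prod_i w i.
  move=> /eigenE zn; rewrite -normX zn /= expr0n addr0 sqrtr_sqr ger0_norm//.
  by apply: prodr_ge0 => i _; exact: ltW.
have -> : spectral_radius M = Normc.normc z0.
  rewrite /spectral_radius -[RHS]sup1; congr sup; apply/seteqP; split => x /=.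
    move=> [z zM <-]; apply: (pexpIrn n_gt0); rewrite ?nnegrE//.
    by rewrite !normE.
  by move=> ->; exists z0.
by split; [exact: normc_ge0|exact: normE].
Qed.

Lemma digraph_ext (T : Type) (g h : digraph T) :
  vset g = vset h -> aset g = aset h -> g = h.
Proof.
case: g h => vg ag gP [vh ah hP] /= vE aE; subst vh ah.
by congr Digraph; exact: Prop_irrelevance.
Qed.

Lemma cycle_successor (T : Type) (g : digraph T) : is_cycle g ->
  exists f : T -> T, forall v, vset g v -> forall w, aset g (v, w) <-> w = f v.
Proof.
move=> [_ _ _ g1].
suff /choice[f fP] : forall v, exists w, vset g v ->
    forall w', aset g (v, w') <-> w' = w by exists f.
move=> v; have [gv|ngv] := pselect (vset g v); last by exists v.
have [w [gw wP]] := g1 _ gv; exists w => _ w'; split => [/wP ->//|-> //].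
Qed.

Lemma cycle_iter (T : Type) (g : digraph T) (f : T -> T) : is_cycle g ->
  (forall v, vset g v -> forall w, aset g (v, w) <-> w = f v) ->
  forall v w, vset g v -> vset g w -> exists m, iter m f v = w.
Proof.
move=> [_ _ [g_conn _] _] fP v w gv gw.
have [<-|vw] := pselect (v = w); first by exists 0%N.
have [p [+ <-]] := g_conn _ _ gv gw vw.
elim: p v {vw} gv => [|x p IH] v gv /=; first by exists 0%N.
move=> /andP[/asboolP vx /(IH x)[|m <-]]; first by have [] := aset_vset vx.
by exists m.+1; rewrite iterSr; have /(fP _ gv) -> := vx.
Qed.

Lemma cycle_aset (T : Type) (g : digraph T) (f : T -> T) :
  (forall v, vset g v -> forall w, aset g (v, w) <-> w = f v) ->
  aset g = [set (v, f v) | v in vset g].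
Proof.
move=> fP; apply/seteqP; split => [[v w] /= vw|_ [v gv <-]]; last exact/fP.
have [gv _] := aset_vset vw.
by exists v => //; have /(fP _ gv) -> := vw.
Qed.

Lemma cycle_fset_aset (T : choiceType) (g : digraph T) (f : T -> T) : is_cycle g ->
  (forall v, vset g v -> forall w, aset g (v, w) <-> w = f v) ->
  fset_set (aset g) = [fset (v, f v) | v in fset_set (vset g)]%fset.
Proof.
by move=> [_ gfin _ _] /cycle_aset ->; rewrite fset_set_image.
Qed.

Lemma cycle_aset_finite (T : Type) (g : digraph T) : is_cycle g -> finite_set (aset g).
Proof.
move=> gc; have [f fP] := cycle_successor gc; have [_ gfin _ _] := gc.
by rewrite (cycle_aset fP); exact: finite_image.
Qed.

Lemma cycle_successor_vset (T : Type) (g : digraph T) (f : T -> T) :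
  (forall v, vset g v -> forall w, aset g (v, w) <-> w = f v) ->
  forall v, vset g v -> vset g (f v).
Proof. by move=> fP v gv; have /fP/aset_vset[] := erefl (f v). Qed.

Lemma cycle_lengthE (T : choiceType) (g : digraph T) : is_cycle g ->
  cycle_length g = #|` fset_set (vset g)|.
Proof.
move=> gc; have [f fP] := cycle_successor gc.
by rewrite /cycle_length (cycle_fset_aset gc fP) card_imfset// => v w [].
Qed.

(** The successor map of [g], read through the enumeration of its vertices, is the transitive map of
    [spectral_radius_cyclic]. Nonnegativity singles out the root of the power equation. *)
Lemma perron_root_cycle (R : realType) (T : choiceType) (g : digraph T)
    (S : T * T -> R) : is_cycle g -> (forall a, aset g a -> 0 < S a) ->
  0 <= perron_root S g /\
  perron_root S g ^+ cycle_length g = \prod_(a <- fset_set (aset g)) S a.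
Proof.
move=> gc S_gt0; have [f fP] := cycle_successor gc.
have [[v0 gv0] gfin _ _] := gc.
rewrite cycle_lengthE// (cycle_fset_aset gc fP) big_imfset/=; last by move=> v w _ _ [].
have inV (v : {: fset_set (vset g)}) : vset g (val v).
  by have := valP v; rewrite in_fset_set// => /set_mem.
have gf := cycle_successor_vset fP.
have Vf (v : {: fset_set (vset g)}) : f (val v) \in fset_set (vset g).
  by rewrite in_fset_set// mem_set//; exact/gf/inV.
pose F v : {: fset_set (vset g)} := FSetSub (Vf v).
pose s (i : 'I_#|{: fset_set (vset g)}|) := enum_rank (F (enum_val i)).
have sE m i : enum_val (iter m s i) = iter m F (enum_val i).
  by elim: m => //= m <-; rewrite enum_rankK.
have FE m v : val (iter m F v) = iter m f (val v).
  by elim: m => //= m <-.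
rewrite cardfE big_seq_fsetE/= (reindex _ (onW_bij _ (@enum_val_bij _)))/=.
apply: (spectral_radius_cyclic (s := s)).
- rewrite -cardfE cardfs_gt0; apply/fset0Pn; exists v0.
  by rewrite in_fset_set// mem_set.
- move=> i j; have [m mP] := cycle_iter gc fP (inV (enum_val i)) (inV (enum_val j)).
  by exists m; apply/enum_val_inj/val_inj; rewrite sE FE.
- by move=> i; apply/S_gt0/fP => //; exact: inV.
- move=> i j; rewrite mxE /=.
  have -> : `[< aset g (val (enum_val i), val (enum_val j)) >] = (j == s i).
    apply/asboolP/eqP => [/fP-/(_ (inV _)) E|->].
      by apply/enum_val_inj/val_inj; rewrite enum_rankK.
    by rewrite enum_rankK; apply/fP => //; exact: inV.
  case: eqP => // ->; by rewrite enum_rankK.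
Qed.

(** * Substochastic weightings and the gap under the two finiteness conditions *)

(** The extended sum is a supremum over finite sets of arcs leaving [v], which correspond to
    duplicate-free lists of heads. Later estimates thus use finite real sums only. *)
Lemma out_weight_le1P (R : realType) (T : choiceType) (D : digraph T)
    (S : T * T -> R) (v : T) :
  (out_weight D S v <= 1)%E <->
  forall s : seq T, uniq s -> (forall w, w \in s -> aset D (v, w)) ->
    \sum_(w <- s) S (v, w) <= 1.
Proof.
split=> [le1 s s_uniq sD|le1].
  have us : uniq [seq (v, w) | w <- s] by rewrite map_inj_uniq// => w w' [].
  rewrite -lee_fin; apply: le_trans le1.
  rewrite -sumEFin -(big_map (pair v) predT (fun a => (S a)%:E)).
  apply: ereal_sup_ubound; exists [set` [seq (v, w) | w <- s]].
    split=> [|_ /= /mapP[w /sD vw ->]]; first exact: finite_seq.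
    by [].
  by rewrite -fsbig_seq.
apply: ge_ereal_sup => _ [X [Xfin XD] <-].
have Xv a : a \in fset_set X -> a = (v, a.2) /\ aset D a.
  by rewrite in_fset_set// => /set_mem/XD[aD <-]; rewrite -surjective_pairing.
rewrite fsbig_finite// sumEFin lee_fin.
rewrite (eq_big_seq (fun a => S (v, a.2))); last by move=> a /Xv[aE _]; rewrite -aE.
rewrite -(big_map snd predT (fun w => S (v, w))); apply: le1.
  rewrite map_inj_in_uniq ?fset_uniq// => a b /Xv[aE _] /Xv[bE _] ab.
  by rewrite aE bE ab.
by move=> w /mapP[a /Xv[aE aD] ->]; rewrite -aE.
Qed.

Section substochastic_cycles.
Context (R : realType) (T : choiceType) (D : digraph T) (S : T * T -> R).
Hypothesis (D_strong : strong D) (S_sub : substochastic R D S).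

Let S_gt0 a : aset D a -> 0 < S a. Proof. by move=> aD; case: S_sub => + _; apply. Qed.

Lemma substochastic_sum_le1 v s : uniq s ->
  (forall w, w \in s -> aset D (v, w)) -> \sum_(w <- s) S (v, w) <= 1.
Proof.
case: s => [|w s] us sD; first by rewrite big_nil ler01.
have [Dv _] := aset_vset (sD _ (mem_head w s)).
have [_ /(_ v Dv)/out_weight_le1P le1] := S_sub; exact: le1.
Qed.

Lemma substochastic_le1 a : aset D a -> S a <= 1.
Proof.
case: a => v w vw; have := @substochastic_sum_le1 v [:: w] isT.
by rewrite big_seq1; apply => x; rewrite inE => /eqP->.
Qed.

Lemma substochastic_pair v w w' : w != w' -> aset D (v, w) -> aset D (v, w') ->
  S (v, w) + S (v, w') <= 1.
Proof.
move=> ww' vw vw'; have := @substochastic_sum_le1 v [:: w; w'].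
rewrite big_cons big_seq1 /= inE ww'; apply => // x.
by rewrite !inE => /orP[]/eqP->.
Qed.


Let weight_ge0_le1 g a : cycle_of g D -> a \in fset_set (aset g) -> 0 <= S a <= 1.
Proof.
move=> [gc [_ gD]]; rewrite in_fset_set; last exact: cycle_aset_finite.
move=> /set_mem/gD aD.
by rewrite ltW ?S_gt0//= substochastic_le1.
Qed.

Lemma cycle_weight_le g a : cycle_of g D -> aset g a ->
  \prod_(a <- fset_set (aset g)) S a <= S a.
Proof.
move=> gD ga; have [gc _] := gD.
have ga' : a \in fset_set (aset g).
  by rewrite in_fset_set ?mem_set//; exact: cycle_aset_finite.
have /andP[Sa0 Sa1] := weight_ge0_le1 gD ga'.
rewrite (big_fsetD1 a)//= ler_piMr//.
rewrite big_seq; apply: prodr_ile1 => b; rewrite !inE => /andP[_].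
exact: weight_ge0_le1.
Qed.

(* Two arcs leaving the same vertex cannot both weigh more than 1/2. *)
Lemma heavy_cycle_sub g h v : cycle_of g D -> cycle_of h D ->
  (forall a, aset g a -> 2^-1 < S a) -> (forall a, aset h a -> 2^-1 < S a) ->
  vset g v -> vset h v -> vset g `<=` vset h /\ aset g `<=` aset h.
Proof.
move=> [gc [_ gD]] [hc [_ hD]] gS hS gv hv.
have [f fP] := cycle_successor gc; have [f' f'P] := cycle_successor hc.
have ff' x : vset g x -> vset h x -> f x = f' x.
  move=> gx hx; apply/eqP/negPn/negP => neq.
  have gf : aset g (x, f x) by exact/fP.
  have hf' : aset h (x, f' x) by exact/f'P.
  have := substochastic_pair neq (gD _ gf) (hD _ hf').
  by apply/negP; rewrite -ltNge; have := gS _ gf; have := hS _ hf'; lra.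
have sub x : vset g x -> vset h x.
  move=> gx; have [m <-] := cycle_iter gc fP gv gx.
  elim: m => [//|m IH] /=.
  have gm : vset g (iter m f v) by elim: (m) => //= k; exact: cycle_successor_vset.
  by rewrite ff'//; exact: cycle_successor_vset.
split=> [//|[x w] xw]; have [gx _] := aset_vset xw.
by apply/(f'P _ (sub _ gx)); rewrite -(ff' _ gx (sub _ gx)); exact: (fP _ gx w).1 xw.
Qed.

Lemma proper_cycle_root_lt1 g : proper_cycle_of g D -> perron_root S g < 1.
Proof.
move=> [gD Dg]; have [gc [_ gDa]] := gD; have [f fP] := cycle_successor gc.
rewrite ltNge; apply: contra Dg => lge1.
have [_ prodE] := perron_root_cycle gc (fun a ga => S_gt0 (gDa a ga)).
(* No factor is smaller than the product, which is at least 1. *)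
have S1 a : aset g a -> 1 <= S a.
  by move=> ga; apply: le_trans (cycle_weight_le gD ga); rewrite -prodE exprn_ege1.
(* An arc of weight 1 leaves no out-weight for a second arc, so no path of [D] can leave [g]. *)
have closed v w : vset g v -> aset D (v, w) -> w = f v.
  move=> gv vw; apply/eqP/negPn/negP => neq.
  have gf : aset g (v, f v) by exact/fP.
  have := substochastic_pair neq vw (gDa _ gf).
  by apply/negP; rewrite -ltNge; have := S1 _ gf; have := S_gt0 vw; lra.
have [[v0 gv0] _ _ _] := gc.
have sub : vset D `<=` vset g.
  move=> w Dw; have [<-//|v0w] := pselect (v0 = w).
  have Dv0 := gD.2.1 _ gv0.
  have [p [+ <-]] := D_strong.1 _ _ Dv0 Dw v0w.
  elim: p (v0) gv0 => //= x p IH v gv /andP[/asboolP/(closed _ _ gv) -> /IH]; apply.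
  exact: cycle_successor_vset.
apply: (@card_le_trans _ _ _ (aset g)).
  apply: subset_card_le => -[v w] vw; have [/sub gv _] := aset_vset vw.
  by apply/fP => //; exact: closed.
have : [set` fset_set (aset g)] #= `I_(cycle_length g) by exact/card_eq_fsetP.
rewrite fset_setK; last exact: cycle_aset_finite.
by rewrite card_eq_le => /andP[].
Qed.

(** Each vertex of [s] contributes at most one heavy cycle, so the gap is a minimum of finitely many
    positive numbers. *)
Lemma heavy_proper_cycles_gap (s : seq T) : exists2 d : R, 0 < d &
  forall g v, proper_cycle_of g D -> (forall a, aset g a -> 2^-1 < S a) ->
    v \in s -> vset g v -> perron_root S g <= 1 - d.
Proof.
elim: s => [|v s [d d_gt0 IH]]; first by exists 1.
have [[g0 [g0D g0S g0v]]|none] := pselect (exists g, [/\ proper_cycle_of g D,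
    forall a, aset g a -> 2^-1 < S a & vset g v]); last first.
  exists d => // g x gD gS; rewrite inE => /orP[/eqP-> gv|]; last exact: IH.
  by case: none; exists g.
exists (Num.min d (1 - perron_root S g0)).
  by rewrite lt_min d_gt0/= subr_gt0 proper_cycle_root_lt1.
move=> g x gD gS; rewrite inE lerBrDl -lerBrDr ge_min.
move=> /orP[/eqP-> gv|xs gx]; apply/orP; [right|left].
  have [sv sa] := heavy_cycle_sub gD.1 g0D.1 gS g0S gv g0v.
  have [sv' sa'] := heavy_cycle_sub g0D.1 gD.1 g0S gS g0v gv.
  by have -> : g = g0 by apply: digraph_ext; exact/seteqP.
by have := IH _ _ gD gS xs gx; rewrite lerBrDl -lerBrDr.
Qed.

Lemma proper_cycle_gap : has_finite_transversal D -> bounded_cycle_lengths D ->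
  exists2 d : R, 0 < d & forall g, proper_cycle_of g D -> perron_root S g <= 1 - d.
Proof.
move=> [X [/finite_seqP[s ->] [_ Xtr]]] [L LP].
have [d d_gt0 dP] := heavy_proper_cycles_gap s.
(* Chosen so that Bernoulli's inequality gives [(1 - e) ^+ L > 2^-1]: a cycle with an arc of weight
   at most 1/2 has product at most 1/2, hence root at most [1 - e]. *)
pose e : R := 2^-1 / L.+1%:R.
have e_gt0 : 0 < e by rewrite divr_gt0 ?invr_gt0 ?ltr0Sn.
have eL : L%:R * e < 2^-1.
  by rewrite mulrCA gtr_pMr ?invr_gt0 ?ltr0Sn// ltr_pdivrMr ?ltr0Sn// mul1r ltr_nat.
have e_le1 : e <= 1.
  rewrite ler_pdivrMr ?ltr0Sn// mul1r.
  by have : 1 <= L.+1%:R :> R; [rewrite ler1n|lra].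
have bernoulli n : 1 - n%:R * e <= (1 - e) ^+ n.
  elim: n => [|n IH]; first by rewrite mul0r subr0.
  rewrite exprS; have e1 : 0 <= 1 - e by rewrite subr_ge0.
  apply: le_trans (ler_wpM2l e1 IH); rewrite -natr1.
  have : 0 <= n%:R * e * e by rewrite !mulr_ge0 ?ler0n// ltW.
  lra.
exists (Num.min d e); first by rewrite lt_min d_gt0.
move=> g gD; rewrite lerBrDl -lerBrDr ge_min.
have [gS|] := pselect (forall a, aset g a -> 2^-1 < S a).
  (* A cycle avoiding the transversal would survive its removal. *)
  have [v [sv gv]] : exists v, v \in s /\ vset g v.
    apply/not_existsP => sg; apply: (Xtr g); split; first by case: gD => -[].
    have [[_ [gDv gDa]] _] := gD.
    split => [v gv|a ga]; first by split; [exact: gDv|move=> sv; case: (sg v)].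
    have [g1 g2] := aset_vset ga; split; first exact: gDa.
    by split=> sa; [case: (sg a.1)|case: (sg a.2)].
  by have := dP _ _ gD gS sv gv; rewrite lerBrDl -lerBrDr => ->.
move=> /existsNP[a /not_implyP[ga /negP]]; rewrite -leNgt => Sa.
apply/orP; right; rewrite lerBrDr -lerBrDl leNgt; apply/negP => lgt.
have [gDc _] := gD; have [gc [_ gDa]] := gDc.
have [_ prodE] := perron_root_cycle gc (fun a ga => S_gt0 (gDa a ga)).
have := le_trans (cycle_weight_le gDc ga) Sa; rewrite -prodE; apply/negP; rewrite -ltNge.
have e1 : 0 <= 1 - e by rewrite subr_ge0.
apply: (@lt_le_trans _ _ ((1 - e) ^+ L)).
  by apply: lt_le_trans (bernoulli L); move: eL; lra.
apply: (@le_trans _ _ ((1 - e) ^+ cycle_length g)).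
  by apply: ler_wiXn2l => //; [rewrite lerBlDr lerDl ltW|exact: LP].
by apply: lerXn2r; rewrite ?nnegrE// ?(le_trans e1)// ltW.
Qed.

End substochastic_cycles.

(** * Least indices and numerical estimates *)

(** For an empty [P] any [n] serves, so least indices can be chosen as total functions of a vertex
    or an arc. *)
Lemma first_nat (P : nat -> Prop) :
  exists n, forall m, P m -> P n /\ (n <= m)%N.
Proof.
have [[n Pn]|nP] := pselect (exists n, P n); last first.
  by exists 0%N => m Pm; case: nP; exists m.
have exP : exists n, `[< P n >] by exists n; apply/asboolP.
exists (ex_minn exP) => m Pm; case: ex_minnP => k /asboolP Pk kP.
by split=> //; apply: kP; apply/asboolP.
Qed.

Lemma expr_small (R : realType) (q c : R) : 0 <= q < 1 -> 0 < c ->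
  exists N, q ^+ N <= c.
Proof.
move=> /andP[q0 q1] c0.
have q_cvg := @cvg_expr R q; rewrite ger0_norm// in q_cvg.
have /cvgrPdist_lt/(_ c c0)[N _ /(_ N (leqnn N))/=] := q_cvg q1.
by rewrite sub0r normrN ger0_norm ?exprn_ge0// => /ltW; exists N.
Qed.

Lemma sum_half_pow_le1 (R : realType) (s : seq nat) : uniq s ->
  \sum_(m <- s) (2^-1 : R) ^+ m.+1 <= 1.
Proof.
(* The sharper bound for exponents below [M] is what the induction on [M] carries. *)
suff bound M : forall s : seq nat, uniq s -> (forall m, m \in s -> (m < M)%N) ->
    \sum_(m <- s) (2^-1 : R) ^+ m.+1 <= 1 - 2^-1 ^+ M.
  move=> us; apply: le_trans (bound (\max_(m <- s) m).+1 _ us _) _.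
    by move=> m ms; rewrite ltnS (big_rem m)//= leq_maxl.
  by rewrite gerBl exprn_ge0// invr_ge0 ler0n.
elim: M => [|M IH] {}s us sM.
  case: s us sM => [|m s] _ sM; first by rewrite big_nil subrr.
  by have := sM _ (mem_head _ _).
have half_ge0 : 0 <= (2^-1 : R) ^+ M by rewrite exprn_ge0// invr_ge0 ler0n.
rewrite [_ ^+ M.+1]exprS; have [Ms|Ms] := boolP (M \in s).
  rewrite (big_rem M)//= exprS.
  have := IH (rem M s) (rem_uniq _ us); move=> /(_ _)/wrap[m|].
    by rewrite mem_rem_uniq// inE => /andP[mM /sM]; rewrite ltnS leq_eqVlt (negPf mM).
  by lra.
have /(_ _)/wrap[m ms|] := IH s us; last by lra.
by have := sM _ ms; rewrite ltnS leq_eqVlt => /predU1P[mM|//]; rewrite -mM ms in Ms.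
Qed.

Lemma sum_indicator_le1 (R : realType) (T : eqType) (P : pred T) (s : seq T) :
  (forall w w', P w -> P w' -> w = w') -> uniq s ->
  \sum_(w <- s) (P w)%:R <= 1 :> R.
Proof.
move=> P1; elim: s => [|w s IH]; first by rewrite big_nil ler01.
rewrite big_cons /= => /andP[ws us]; have [Pw|_] := boolP (P w); last first.
  by rewrite add0r IH.
rewrite big1_seq ?addr0// => w' /andP[_ w's].
by have [/(P1 _ _ Pw) ww'|//] := boolP (P w'); rewrite ww' w's in ws.
Qed.

(** * Cycles when one of the two conditions fails *)

(** By contraposition, every cycle of [D] is proper when one of the two conditions fails. *)
Lemma finite_arcs_bounded (T : choiceType) (D : digraph T) n :
  strong D -> aset D #<= `I_n ->
  has_finite_transversal D /\ bounded_cycle_lengths D.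
Proof.
move=> [_ D_out] Dn; have Dfin : finite_set (aset D) by apply/finite_set_leP; exists n.
split.
  exists (vset D); split.
    apply: (sub_finite_set _ (finite_image fst Dfin)) => v /D_out[w vw].
    by exists (v, w).
  split=> [//|g [[[v gv] _ _ _] [gD _]]].
  by have [] := gD _ gv.
exists n => g [gc [_ gD]].
by apply: geq_card_fset_set; apply: card_le_trans Dn; exact: subset_card_le.
Qed.

(** With unbounded lengths, a cycle longer than [N] times the size of [F] will do. Without a finite
    transversal, some cycle avoids [F] and the left side is 0. *)
Lemma sparse_cycle (T : choiceType) (D : digraph T) :
  ~ (has_finite_transversal D /\ bounded_cycle_lengths D) ->
  forall (F : {fset T}) N, exists g, cycle_of g D /\
    (N * #|` (F `&` fset_set (vset g))%fset| <= cycle_length g)%N.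
Proof.
move=> notboth F N; have [ft|nft] := pselect (has_finite_transversal D).
  have nb : ~ bounded_cycle_lengths D by move=> b; exact: notboth.
  apply: contrapT => /forallNP none; apply: nb; exists (N * #|` F|)%N => g gD.
  have [//|/ltnW lt] := leqP (cycle_length g) (N * #|` F|).
  case: (none g); split=> //; apply: leq_trans lt.
  by rewrite leq_mul2l fsubset_leq_card ?orbT// fsubsetIl.
apply: contrapT => /forallNP none; apply: nft.
exists ([set` F] `&` vset D); split; first exact: finite_setIl.
split=> [|g [gc [gV gA]]]; first exact: subIsetr.
case: (none g); split.
  by split=> //; split=> [v /gV[]//|a /gA[]].
suff -> : (F `&` fset_set (vset g) = fset0)%fset by rewrite cardfs0 muln0.
apply/fsetP => v; rewrite !inE; apply/negP => /andP[vF].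
have [_ gfin _ _] := gc.
by rewrite in_fset_set// => /set_mem/gV[Dv]; apply.
Qed.

(** * A weighting concentrated along a sequence of cycles *)

Section heavy_along_cycles.
Context (R : realType) (T : choiceType) (D : digraph T) (S0 : T * T -> R).
Hypothesis S0_sub : substochastic R D S0.
Context (G : nat -> digraph T) (k : T -> nat) (r : T * T -> nat).
Hypothesis G_cycle : forall n, cycle_of (G n) D.
(* k v and r a are the least n such that v, respectively a, lies in G n, when
   there is one, and unspecified otherwise. *)
Hypothesis kP : forall v m, vset (G m) v -> vset (G (k v)) v /\ (k v <= m)%N.
Hypothesis rP : forall a m, aset (G m) a -> aset (G (r a)) a /\ (r a <= m)%N.

(** If [a.1] lies on no [G n], the test fails whatever [k] is, and no arc leaving it is heavy. *)
Definition heavy_arc (a : T * T) : bool := `[< aset (G (k a.1)) a >].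

(* By injectivity of w |-> r (v, w) on the arcs lying in some G n, these weights
   sum to at most 1 at each vertex v. *)
Definition dyadic_weight (a : T * T) : R :=
  `[< aset (G (r a)) a >]%:R * 2^-1 ^+ (r a).+1.

Definition light_budget (v : T) : R := (k v).+2%:R^-1.

(** The [S0] term keeps every arc of [D] positive; the dyadic term bounds the arcs of [G n] below
    independently of [S0]. *)
Definition along_cycles (a : T * T) : R :=
  (1 - light_budget a.1) * (heavy_arc a)%:R +
  light_budget a.1 * (2^-1 * (S0 a + dyadic_weight a)).

Let light_gt0 v : 0 < light_budget v. Proof. by rewrite invr_gt0 ltr0Sn. Qed.

Let light_le1 v : light_budget v <= 1.
Proof. by rewrite invf_le1 ?ltr0Sn// ler1n. Qed.

Let dyadic_ge0 a : 0 <= dyadic_weight a.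
Proof. by rewrite mulr_ge0 ?ler0n// exprn_ge0// invr_ge0 ler0n. Qed.

Let S0_gt0 a : aset D a -> 0 < S0 a. Proof. by case: S0_sub => + _; apply. Qed.

Let cycle_unique n v w w' : aset (G n) (v, w) -> aset (G n) (v, w') -> w = w'.
Proof.
have [[_ _ _ G1] _] := G_cycle n.
move=> vw vw'; have [gv _] := aset_vset vw.
by have [x [_ xP]] := G1 _ gv; rewrite -(xP _ vw) -(xP _ vw').
Qed.

Let dyadic_sum_le1 v s : uniq s -> \sum_(w <- s) dyadic_weight (v, w) <= 1.
Proof.
move=> us; pose P w := `[< aset (G (r (v, w))) (v, w) >].
have -> : \sum_(w <- s) dyadic_weight (v, w) =
    \sum_(m <- [seq r (v, w) | w <- s & P w]) 2^-1 ^+ m.+1.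
  rewrite big_map big_filter [RHS]big_mkcond; apply: eq_bigr => w _.
  by rewrite /dyadic_weight /P; case: asboolP; rewrite ?mul1r ?mul0r.
apply: sum_half_pow_le1; rewrite map_inj_in_uniq ?filter_uniq// => w w'.
rewrite !mem_filter => /andP[/asboolP + _] /andP[/asboolP + _] rww'.
by rewrite /= rww'; exact: cycle_unique.
Qed.

(** At each vertex the weights are a convex combination of three families, each of sum at most 1. *)
Lemma along_cycles_substochastic : substochastic R D along_cycles.
Proof.
split=> [a aD|v Dv].
  rewrite ltr_wpDl ?mulr_ge0 ?subr_ge0 ?ler0n//.
  by rewrite !mulr_gt0 ?invr_gt0 ?ltr0n ?light_gt0// ltr_wpDr ?S0_gt0.
apply/out_weight_le1P => s us sD; rewrite big_split/= -!mulr_sumr big_split/=.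
have S0_le1 := substochastic_sum_le1 S0_sub us sD.
have t_le1 := dyadic_sum_le1 v us.
have h_le1 : \sum_(w <- s) (heavy_arc (v, w))%:R <= 1 :> R.
  apply: (@sum_indicator_le1 _ _ (fun w => heavy_arc (v, w))) => // w w'.
  by move=> /asboolP + /asboolP; exact: cycle_unique.
have e1 : 0 <= 1 - light_budget v by rewrite subr_ge0.
have := ler_wpM2l e1 h_le1; rewrite mulr1.
have : 2^-1 * (\sum_(w <- s) S0 (v, w) + \sum_(w <- s) dyadic_weight (v, w)) <= 1.
  by lra.
by move/(ler_wpM2l (ltW (light_gt0 v))); lra.
Qed.

Lemma along_cycles_heavy n a : aset (G n) a -> k a.1 = n ->
  1 - n.+2%:R^-1 <= along_cycles a.
Proof.
move=> na ka; rewrite /along_cycles /heavy_arc /light_budget ka.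
rewrite (asboolT na) mulr1 lerDl mulr_ge0 ?invr_ge0 ?ler0n//.
by rewrite mulr_ge0 ?invr_ge0 ?ler0n// addr_ge0// ltW// S0_gt0//; apply: (G_cycle n).2.2.
Qed.

(** On [G n] both [k] and [r] are at most [n]; the factor 1/2 in [along_cycles] raises the dyadic
    exponent from [n.+1] to [n.+2]. *)
Lemma along_cycles_light n a : aset (G n) a ->
  n.+2%:R^-1 * 2^-1 ^+ n.+2 <= along_cycles a.
Proof.
move=> na; have [gv _] := aset_vset na; have [_ kn] := kP gv; have [rna rn] := rP na.
rewrite /along_cycles -[leLHS]add0r lerD ?mulr_ge0 ?subr_ge0 ?ler0n//.
rewrite ler_pM ?invr_ge0 ?exprn_ge0 ?ler0n//.
  by rewrite lef_pV2 ?posrE ?ltr0Sn// ler_nat !ltnS.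
rewrite exprS ler_wpM2l ?invr_ge0 ?ler0n// -[leLHS]add0r lerD//.
  by apply/ltW/S0_gt0; apply: (G_cycle n).2.2.
rewrite /dyadic_weight (asboolT rna) mul1r; apply: ler_wiXn2l; rewrite ?ltnS//.
by rewrite invf_le1 ?ler1n ?ltr0n.
Qed.

End heavy_along_cycles.

(** * Failure of a uniform gap *)

Lemma cycle_arcs_out_of (T : choiceType) (g : digraph T) (F : {fset T}) :
  is_cycle g -> (\sum_(a <- fset_set (aset g)) (a.1 \in F) <=
    #|` (F `&` fset_set (vset g))%fset|)%N.
Proof.
move=> gc; have [f fP] := cycle_successor gc.
rewrite (cycle_fset_aset gc fP) big_imfset/=; last by move=> v w _ _ [].
have -> : (\sum_(i <- fset_set (vset g)) (i \in F) =
    count (mem F) (fset_set (vset g)))%N.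
  rewrite -sum1_count [RHS]big_mkcond; apply: eq_bigr => v _.
  by rewrite inE; case: (v \in F).
rewrite -size_filter; apply: uniq_leq_size; first by rewrite filter_uniq.
by move=> v; rewrite mem_filter => /andP[vF vV]; apply/fsetIP; split.
Qed.

Lemma no_uniform_gap (R : realType) (T : choiceType) (D : digraph T)
    (S0 : T * T -> R) : strong D -> substochastic R D S0 ->
  ~ (has_finite_transversal D /\ bounded_cycle_lengths D) ->
  exists2 S, substochastic R D S & forall d, 0 < d ->
    exists2 g, proper_cycle_of g D & 1 - perron_root S g < d.
Proof.
move=> D_strong S0_sub notboth.
pose q n : R := 1 - n.+2%:R^-1.
have q_ge0 n : 0 <= q n by rewrite subr_ge0 invf_le1 ?ltr0Sn// ler1n.
have q_lt1 n : q n < 1 by rewrite gtrBl invr_gt0 ltr0Sn.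
(* The lower bound for light arcs of [G n] depends on [n] only, so [N n] can be fixed before [G n]
   is chosen. *)
have /choice[N NP] : forall n, exists N, q n ^+ N <= n.+2%:R^-1 * 2^-1 ^+ n.+2.
  move=> n; apply: expr_small; first by rewrite q_ge0 q_lt1.
  by rewrite mulr_gt0 ?exprn_gt0 ?invr_gt0 ?ltr0Sn.
have /choice[pick pickP] : forall FN : {fset T} * nat, exists g, cycle_of g D /\
    (FN.2 * #|` (FN.1 `&` fset_set (vset g))%fset| <= cycle_length g)%N.
  by move=> [F M]; exact: sparse_cycle.
(* [Fs n] collects the vertices of the cycles chosen before step [n]. *)
pose Fs := fix Fs n := if n is m.+1 then
  (Fs m `|` fset_set (vset (pick (Fs m, N m))))%fset else fset0.
pose G n := pick (Fs n, N n).
have GD n : cycle_of (G n) D := (pickP (Fs n, N n)).1.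
have Gsparse n :
    (N n * #|` (Fs n `&` fset_set (vset (G n)))%fset| <= cycle_length (G n))%N.
  exact: (pickP (Fs n, N n)).2.
have GFs m n v : (m < n)%N -> vset (G m) v -> v \in Fs n.
  move=> + gv; elim: n => // n IH; rewrite ltnS leq_eqVlt => /predU1P[<-|/IH vF].
    have [[_ gfin _ _] _] := GD m.
    by rewrite /= inE (in_fset_set gfin) mem_set ?orbT.
  by rewrite /= inE vF.
have /choice[k kP] := fun v => first_nat (fun n => vset (G n) v).
have /choice[r rP] := fun a => first_nat (fun n => aset (G n) a).
pose S := along_cycles S0 G k r.
have S_sub : substochastic R D S by exact: along_cycles_substochastic.
exists S => // d d_gt0.
(* The arcs leaving used vertices weigh at least q n ^+ N n; by the sparseness of
   G n they cost at most one more factor q n per arc of G n. *)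
have root_ge n : q n ^+ 2 <= perron_root S (G n).
  have [gc [_ gD]] := GD n.
  have [root_ge0 rootE] := perron_root_cycle gc (fun a ga => S_sub.1 _ (gD a ga)).
  have l_gt0 : (cycle_length (G n) != 0)%N.
    have [[v gv] gfin _ _] := gc; rewrite cycle_lengthE// cardfs_eq0.
    by apply/fset0Pn; exists v; rewrite in_fset_set// mem_set.
  rewrite leNgt; apply/negP => lt; have := ltrXn2r (cycle_length (G n)) root_ge0 lt.
  rewrite l_gt0 rootE; apply/negP; rewrite -leNgt -exprM.
  apply: (@le_trans _ _ (\prod_(a <- fset_set (aset (G n)))
      q n ^+ (1 + N n * (a.1 \in Fs n)))).
    rewrite prodrXr; apply: ler_wiXn2l; rewrite ?q_ge0 ?(ltW (q_lt1 n))//.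
    rewrite big_split/= sum1_size -big_distrr/= mul2n -addnn leq_add//.
    apply: leq_trans (Gsparse n); rewrite leq_mul2l; apply/orP; right.
    exact: cycle_arcs_out_of.
  rewrite big_seq [leRHS]big_seq; apply: ler_prod => a.
  rewrite in_fset_set; last exact: cycle_aset_finite.
  move=> /set_mem ga; rewrite exprn_ge0//=.
  have [gv _] := aset_vset ga; have [gk kn] := kP _ _ gv.
  have [aF|aF] := boolP (a.1 \in Fs n).
    apply: le_trans (along_cycles_light S0_sub GD kP rP ga); apply: le_trans (NP n).
    by rewrite muln1 exprD expr1 ler_piMl ?exprn_ge0// ltW.
  (* A vertex outside [Fs n] lies on no earlier cycle, so [k] sends it to [n] and its arc in [G n]
     is heavy. *)
  rewrite muln0 addn0 expr1; apply: (along_cycles_heavy S0_sub r GD ga).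
  apply/eqP; rewrite eqn_leq kn leqNgt; apply: contra aF => kn_lt.
  exact: GFs kn_lt gk.
(* Half of [d] suffices because [1 - q n ^+ 2] is at most [2 / n.+2]. *)
have [n] := ltr_add_invr (divr_gt0 d_gt0 (ltr0Sn _ 1)); rewrite add0r => nd.
exists (G n).
  split=> //; apply: contra_notN notboth; exact: finite_arcs_bounded.
have := root_ge n; rewrite /q expr2.
have : n.+2%:R^-1 <= n.+1%:R^-1 :> R by rewrite lef_pV2 ?posrE ?ltr0Sn// ler_nat.
have : 0 <= n.+2%:R^-1 :> R by rewrite invr_ge0 ler0n.
move: nd; set x := n.+1%:R^-1; set y := n.+2%:R^-1 => xd y0 yx.
have : 0 <= y * y by rewrite mulr_ge0.
lra.
Qed.

Local Close Scope card_scope.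
Local Close Scope complex_scope.
Local Close Scope ring_scope.

Theorem proposition2 (R : realType) (T : choiceType) (D : digraph T)
    (D_strong : strong D)
    (S_nonempty : substochastic R D !=set0) :
  (forall S : T * T -> R, substochastic R D S ->
    (0 < ereal_inf [set (1 - perron_root S g)%R%:E
                   | g in [set g | proper_cycle_of g D]])%E)
  <-> has_finite_transversal D /\ bounded_cycle_lengths D.
Proof.
split=> [gap|[ft bl] S S_sub].
  apply: contrapT => notboth; have [S0 S0_sub] := S_nonempty.
  have [S S_sub small] := no_uniform_gap D_strong S0_sub notboth.
  have [d d_gt0 dP] : exists2 d : R, (0 < d)%R & forall g, proper_cycle_of g D ->
      (d <= 1 - perron_root S g)%R.
    have := gap S S_sub; set m := ereal_inf _.
    have mP g : proper_cycle_of g D -> (m <= (1 - perron_root S g)%R%:E)%E.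
      by move=> gD; apply: ereal_inf_lbound; exists g.
    case: m mP => [d| |] mP; last by rewrite ltNge leNye.
      by rewrite lte_fin => d_gt0; exists d => // g /mP; rewrite lee_fin.
    (* An infimum of [+oo] means that there is no proper cycle, so any positive [d] serves. *)
    by move=> _; exists 1%R => [|g /mP]; rewrite ?ltr01 ?leye_eq.
  have [g /dP] := small d d_gt0; rewrite leNgt => /negP; exact.
have [d d_gt0 dP] := proper_cycle_gap D_strong S_sub ft bl.
apply: (@lt_le_trans _ _ d%:E); first by rewrite lte_fin.
apply/ereal_infP => _ [g gD <-]; rewrite lee_fin lerBrDr addrC -lerBrDr.
exact: dP.
Qed.
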